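(* Let $\pi_n$ be a uniformly random permutation of $[n]=\{1,\dots,n\}$ and let $X_n$ be the number of distinct consecutive patterns, of all lengths $k\in\{1,2,\ldots,n\}$, contained in $\pi_n$. Then for all sufficiently large $n$, \[\mathbb E(X_n)\ge \frac{n^2}{2}\left(1-\frac{17\ln n}{n}\right).\]
   Context: Permutations are written in one-line notation. A permutation $\pi$ of $[n]$ consecutively contains a pattern $\mu$ (a permutation of $[k]$) if there is an index $m$ with $1\le m\le n-k+1$ such that $(\pi(m),\pi(m+1),\ldots,\pi(m+k-1))$ is in the same relative order as $(\mu(1),\ldots,\mu(k))$. $X_n$ counts the number of patterns $\mu$ (of any length $1\le k\le n$) that $\pi_n$ consecutively contains. *)

(* Defs.v *)
From mathcomp Require Import all_boot all_fingroup all_algebra.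
From mathcomp Require Import all_classical all_reals all_analysis.

Set Implicit Arguments.
Unset Strict Implicit.
Unset Printing Implicit Defensive.

(* Permutations of [n] are elements of 'S_n: positions and values are numbered
   from 0 to n - 1 instead of from 1 to n, which does not affect relative
   orders. *)

Definition one_line (n : nat) (s : 'S_n) : seq nat :=
  [seq nat_of_ord (s i) | i <- enum 'I_n].

(* The entries at positions m, ..., m + k - 1 of s are in the same relative
   order as the entries of mu. The default value of nth is never used, because
   m + k <= n. *)
Definition consec_contains_at (n k : nat) (s : 'S_n) (mu : 'S_k) (m : nat) :
    bool :=
  (m + k <= n) &&
  [forall i : 'I_k, forall j : 'I_k,
     (nth 0 (one_line s) (m + i) < nth 0 (one_line s) (m + j))
       == (mu i < mu j)].

(* m + k <= n forces m <= n, so m loses nothing by ranging over 'I_n.+1. *)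
Definition consec_contains (n k : nat) (s : 'S_n) (mu : 'S_k) : bool :=
  [exists m : 'I_n.+1, consec_contains_at s mu m].

Definition num_consec_patterns (n : nat) (s : 'S_n) : nat :=
  \sum_(1 <= k < n.+1) #|[set mu : 'S_k | consec_contains s mu]|.

Local Open Scope ring_scope.

Definition uniform_pmf (R : realType) (T : finType) : T -> R :=
  fun=> #|T|%:R^-1.
Arguments uniform_pmf : clear implicits.

Definition finite_expectation (R : realType) (T : finType) (p X : T -> R) : R :=
  \sum_(t : T) p t * X t.

(* Main.v *)
(* There are n - k + 1 windows of length k, so pi contains at least n - k + 1
   minus the number of pairs of windows of length k with equal patterns.  If
   k >= 2 M and the windows at m and m + d have the same pattern, iterating the
   shift by d produces two disjoint windows of length M with the same pattern,
   which has probability at most 1 / M!.  With M close to 2 ln n we have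
   M! >= n^2, so the at most n^3 pairs cost at most n in expectation, and
   discarding the lengths k < 2 M costs at most 2 M n <= 4 n ln n. *)

Require Import Defs.
From mathcomp Require Import all_boot all_order all_fingroup all_algebra.
From mathcomp Require Import zify ring lra.
From mathcomp Require Import all_classical all_reals all_analysis.

Set Implicit Arguments.
Unset Strict Implicit.
Unset Printing Implicit Defensive.

(** * Standardisation: the pattern of an injective sequence *)

Definition rank (k : nat) (u : 'I_k -> nat) (i : 'I_k) : nat :=
  #|[set j | u j < u i]|.

Lemma rank_lt k (u : 'I_k -> nat) (i : 'I_k) : rank u i < k.
Proof.
rewrite /rank -[X in _ < X]card_ord -cardsT; apply/proper_card/properP.
by split; [exact: finset.subsetT | exists i; rewrite !inE ?ltnn].
Qed.

Lemma ltn_rank k (u : 'I_k -> nat) i j : (rank u i < rank u j) = (u i < u j).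
Proof.
case: (ltnP (u i) (u j)) => [uij|uji]; last first.
  apply/negbTE; rewrite -leqNgt; apply/subset_leq_card/fintype.subsetP => l.
  by rewrite !inE => /leq_trans; apply.
apply/proper_card/properP; split; last by exists i; rewrite !inE ?ltnn.
by apply/fintype.subsetP => l; rewrite !inE => /ltn_trans; apply.
Qed.

Lemma rank_inj k (u : 'I_k -> nat) : injective u -> injective (rank u).
Proof.
move=> u_inj i j rij; apply: u_inj; apply/eqP.
by case: ltngtP => //; rewrite -(ltn_rank u) rij ltnn.
Qed.

Lemma rank_ord_inj k (u : 'I_k -> nat) (u_inj : injective u) :
  injective (fun i => Ordinal (rank_lt u i)).
Proof. by move=> i j [] /(rank_inj u_inj). Qed.

Definition pattern_of k (u : 'I_k -> nat) (u_inj : injective u) : 'S_k :=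
  perm (rank_ord_inj u_inj).

Lemma ltn_pattern_of k (u : 'I_k -> nat) (u_inj : injective u) i j :
  (pattern_of u_inj i < pattern_of u_inj j) = (u i < u j).
Proof. by rewrite !permE /= ltn_rank. Qed.

(** Such an [r] maps the indices of entries below [u i] bijectively onto those below [u (r i)], so
    it preserves [rank u], which is injective. *)
Lemma increasing_perm_eq1 k (u : 'I_k -> nat) (r : 'S_k) : injective u ->
  (forall i j, (u (r i) < u (r j)) = (u i < u j)) -> r = 1%g.
Proof.
move=> u_inj ru; apply/permP => i; rewrite perm1; apply: (rank_inj u_inj).
rewrite /rank -(card_imset [set j | u j < u i] (@perm_inj _ r)).
apply: eq_card => j; rewrite inE; apply/idP/imsetP => [uj|[l]].
  by exists ((r^-1)%g j); rewrite ?inE ?permKV // -ru permKV.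
by rewrite inE -ru => ? ->.
Qed.

Lemma order_iso_perm_eq k (u v : 'I_k -> nat) (t1 t2 : 'S_k) : injective u ->
  (forall i j, (u (t1 i) < u (t1 j)) = (v i < v j)) ->
  (forall i j, (u (t2 i) < u (t2 j)) = (v i < v j)) -> t1 = t2.
Proof.
move=> u_inj u1 u2.
have : (t1^-1 * t2 = 1)%g.
  apply: (increasing_perm_eq1 u_inj) => i j.
  by rewrite !permM u2 -u1 !permKV.
by move/eqP; rewrite -eq_mulVg1 => /eqP.
Qed.

(** * Rearranging a permutation along a family of positions *)

Section PermAlong.
Variables (n e : nat) (g : 'I_e -> 'I_n).
Hypothesis g_inj : injective g.

Definition fun_along (t : 'S_e) (x : 'I_n) : 'I_n :=
  if [pick i | g i == x] is Some i then g (t i) else x.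

Lemma fun_along_in t i : fun_along t (g i) = g (t i).
Proof.
rewrite /fun_along; case: pickP => [j /eqP/g_inj-> //|/(_ i)].
by rewrite eqxx.
Qed.

Lemma fun_along_out t x : (forall i, g i != x) -> fun_along t x = x.
Proof.
move=> gx; rewrite /fun_along; case: pickP => [j|//].
by rewrite (negbTE (gx j)).
Qed.

Lemma fun_along_inj t : injective (fun_along t).
Proof.
apply: (@can_inj _ _ _ (fun_along t^-1)) => x.
have [/existsP[i /eqP<-]|/existsPn gx] := boolP [exists i, g i == x].
  by rewrite !fun_along_in permK.
by rewrite !fun_along_out.
Qed.

Definition perm_along (t : 'S_e) : 'S_n := perm (@fun_along_inj t).

Lemma perm_along_in t i : perm_along t (g i) = g (t i).
Proof. by rewrite permE fun_along_in. Qed.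

Lemma perm_along_out t x : (forall i, g i != x) -> perm_along t x = x.
Proof. by move=> gx; rewrite permE fun_along_out. Qed.

End PermAlong.

Definition same_order_on n e (f g : 'I_e -> 'I_n) (s : 'S_n) : bool :=
  [forall i, forall j, (s (f i) < s (f j)) == (s (g i) < s (g j))].

(* Rearranging the entries along [g] in all e! ways sends the permutations
   counted here to pairwise distinct permutations: the entries along [f] are
   untouched, so they still show which rearrangement was applied. *)
Lemma card_same_order_on n e (f g : 'I_e -> 'I_n) :
  injective f -> injective g -> (forall i j, g i != f j) ->
  #|[set s | same_order_on f g s]| * e`! <= n`!.
Proof.
move=> f_inj g_inj fg.
rewrite -[e`!]card_Sn -[n`!]card_Sn -cardsT -cardsX.
pose h (p : 'S_n * 'S_e) := (perm_along g_inj p.2 * p.1)%g.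
have hg p i : h p (g i) = p.1 (g (p.2 i)) by rewrite permM perm_along_in.
have hf p i : h p (f i) = p.1 (f i).
  by rewrite permM perm_along_out.
rewrite -(@card_in_imset _ _ h); first exact: max_card.
move=> [s1 t1] [s2 t2]; rewrite !inE !andbT /= => A1 A2 eq_h.
have h12 : h (s1, t1) = h (s2, t2) by [].
have t12 : t1 = t2.
  (* Both [t1] and [t2] carry the order of the common image along [g] to its order along [f], and at
     most one permutation does so. *)
  apply: (@order_iso_perm_eq _ (fun i => h (s1, t1) (f i))
                               (fun i => h (s1, t1) (g i))).
  - by move=> i j /ord_inj/perm_inj/f_inj.
  - move=> i j; rewrite !hf !hg /=.
    by move/forallP: A1 => /(_ (t1 i))/forallP/(_ (t1 j))/eqP.
  - move=> i j; rewrite h12 !hf !hg /=.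
    by move/forallP: A2 => /(_ (t2 i))/forallP/(_ (t2 j))/eqP.
by move: eq_h; rewrite t12 => /mulgI /= ->.
Qed.

(** * Collisions, and comparison of windows under repeated shifts *)

(** Deleting the larger index of every colliding pair leaves indices with distinct values and
    deletes at most one index per pair. *)
Lemma leq_card_codom_collisions (T : finType) p (f : 'I_p -> T) :
  p <= #|[set f i | i in 'I_p]| +
       #|[set ij : 'I_p * 'I_p | (ij.1 < ij.2) && (f ij.1 == f ij.2)]|.
Proof.
set P := [set ij | _]; pose D := [set ij.2 | ij in P].
rewrite -{1}(card_ord p) -(cardsC (~: D)) finset.setCK.
rewrite leq_add ?leq_imset_card//.
rewrite -(@card_in_imset _ _ f).
  by apply/subset_leq_card/fintype.subsetP => _ /imsetP[i _ ->]; exact: imset_f.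
suff Dn (i j : 'I_p) : j \in ~: D -> i < j -> f i <> f j.
  move=> i j iD jD fij; apply/ord_inj/eqP.
  case: ltngtP => // [/(Dn _ _ jD)|/(Dn _ _ iD)]; by rewrite fij.
move=> jD ij fij; move: jD; rewrite !inE => /imsetP; apply.
by exists (i, j) => //; rewrite inE /= ij fij eqxx.
Qed.

(** Each of the [t] steps moves both positions back by [d]; since [k + d] is the end of the shifted
    window, the hypothesis applies at every step. *)
Lemma order_periodic (u : nat -> nat) d k :
  (forall i j, i < k -> j < k -> (u (d + i) < u (d + j)) = (u i < u j)) ->
  forall t i j, t * d + i < k + d -> t * d + j < k + d ->
  (u (t * d + i) < u (t * d + j)) = (u i < u j).
Proof.
move=> ud; elim=> [//|t IHt] i j; rewrite mulSn -!addnA => ti tj.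
by rewrite ud ?IHt; lia.
Qed.

Lemma nth_one_line n (s : 'S_n) (i : 'I_n) : nth 0 (one_line s) i = s i.
Proof. by rewrite /one_line (nth_map i) ?size_enum_ord// nth_ord_enum. Qed.

Definition window n (s : 'S_n) k (m : nat) (i : 'I_k) : nat :=
  nth 0 (one_line s) (m + i).

Lemma window_inj n (s : 'S_n) k m : m + k <= n -> injective (@window n s k m).
Proof.
move=> mk i j; have lt_n (l : 'I_k) : m + l < n by have := ltn_ord l; lia.
rewrite /window (nth_one_line s (Ordinal (lt_n i))).
rewrite (nth_one_line s (Ordinal (lt_n j))) => /ord_inj/perm_inj[] /addnI.
exact: ord_inj.
Qed.

(* The shift from m to m + d, iterated until it exceeds M, compares two disjoint
   windows of length M. *)
Lemma card_same_window_order n k M m d : 0 < d -> 2 * M <= k ->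
  m + d + k <= n ->
  #|[set s : 'S_n | [forall i : 'I_k, forall j : 'I_k,
      (window s (m + d) i < window s (m + d) j) ==
      (window s m i < window s m j)]]| * M`! <= n`!.
Proof.
(* [D] is the least positive multiple of [d] that is at least [M]: the blocks at [m] and [m + D] are
   disjoint, and [D <= M.-1 + d] with [2 * M <= k] keeps the second one inside the window at
   [m + d]. *)
move=> d_gt0 Mk mdk; pose D := (M.-1 %/ d).+1 * d.
have MD : M <= D by have := ltn_ceil M.-1 d_gt0; rewrite /D; lia.
have Dd : D + M <= k + d by have := leq_divM M.-1 d; rewrite /D mulSn; lia.
have ltf (i : 'I_M) : m + i < n by have := ltn_ord i; lia.
have ltg (i : 'I_M) : m + (D + i) < n by have := ltn_ord i; lia.
pose f i := Ordinal (ltf i); pose g i := Ordinal (ltg i).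
apply: leq_trans (@card_same_order_on n M f g _ _ _); last first.
- by move=> i j; rewrite -val_eqE /=; have := ltn_ord j; lia.
- by move=> i j [] /addnI/addnI; exact: ord_inj.
- by move=> i j [] /addnI; exact: ord_inj.
apply: leq_mul => //; apply/subset_leq_card/fintype.subsetP => s.
rewrite !inE => /forallP sP; apply/forallP => i; apply/forallP => j.
rewrite -!nth_one_line /=; apply/eqP/esym.
apply: (@order_periodic (fun x => nth 0 (one_line s) (m + x)) d k)
  => [a b ak bk||].
- have /forallP/(_ (Ordinal bk))/eqP := sP (Ordinal ak).
  by rewrite /window /= !addnA.
- by have := ltn_ord i; rewrite -/D; lia.
- by have := ltn_ord j; rewrite -/D; lia.
Qed.

(** * Window patterns of a fixed length, summed over all permutations *)

Section WindowPatterns.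
Variables (n k : nat).
Hypothesis kn : k <= n.

Lemma window_bound (m : 'I_(n - k).+1) : m + k <= n.
Proof. by have := ltn_ord m; lia. Qed.

Definition window_pattern (s : 'S_n) (m : 'I_(n - k).+1) : 'S_k :=
  pattern_of (window_inj (s := s) (window_bound m)).

Lemma window_pattern_contained s m : consec_contains s (window_pattern s m).
Proof.
have mn : m < n.+1 by have := window_bound m; lia.
apply/existsP; exists (Ordinal mn); rewrite /consec_contains_at window_bound /=.
by apply/forallP => i; apply/forallP => j; rewrite ltn_pattern_of.
Qed.

Definition window_collisions (s : 'S_n) :=
  [set ij : 'I_(n - k).+1 * 'I_(n - k).+1 |
    (ij.1 < ij.2) && (window_pattern s ij.1 == window_pattern s ij.2)].

Lemma leq_patterns_collisions s :
  (n - k).+1 <= #|[set mu : 'S_k | consec_contains s mu]| +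
                #|window_collisions s|.
Proof.
apply: (leq_trans (leq_card_codom_collisions (window_pattern s))).
rewrite leq_add2r; apply/subset_leq_card/fintype.subsetP => _ /imsetP[m _ ->].
by rewrite inE window_pattern_contained.
Qed.

Lemma sum_window_collisions M : 2 * M <= k ->
  (\sum_(s : 'S_n) #|window_collisions s|) * M`! <= (n - k).+1 ^ 2 * n`!.
Proof.
move=> Mk; under eq_bigr do rewrite -sum1dep_card big_mkcond.
rewrite exchange_big big_distrl /=.
rewrite (_ : _ ^ 2 = #|{: 'I_(n - k).+1 * 'I_(n - k).+1}|); last first.
  by rewrite card_prod !card_ord.
rewrite -sum_nat_const; apply: leq_sum => -[m1 m2] _ /=.
rewrite -big_mkcond sum1dep_card /=.
have [m12|] := ltnP m1 m2; last first.
  by rewrite (_ : [set _ | _] = finset.set0) ?cards0.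
have m12_gt0 : 0 < m2 - m1 by rewrite subn_gt0.
have m12K : m1 + (m2 - m1) = m2 by rewrite subnKC // ltnW.
have := @card_same_window_order n k M m1 (m2 - m1) m12_gt0 Mk.
rewrite m12K => /(_ (window_bound m2)); apply: leq_trans; apply: leq_mul => //.
apply/subset_leq_card/fintype.subsetP => s; rewrite !inE /= => /eqP s12.
apply/forallP => i; apply/forallP => j.
rewrite -(ltn_pattern_of (window_inj (s := s) (window_bound m1))).
rewrite -(ltn_pattern_of (window_inj (s := s) (window_bound m2))).
by rewrite -/(window_pattern s m1) -/(window_pattern s m2) s12.
Qed.

(** The last term makes the bound valid for every length: when [k < 2 * M] it alone dominates the
    left side, as there are at most [n] windows. *)
Lemma leq_sum_patterns M : 0 < k ->
  n`! * (n.+1 - k) * M`! <=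
    (\sum_(s : 'S_n) #|[set mu : 'S_k | consec_contains s mu]|) * M`! +
    n ^ 2 * n`! + (k < 2 * M) * (n * n`! * M`!).
Proof.
move=> k_gt0; have [Mk|Mk] := ltnP k (2 * M).
  rewrite mul1n; apply: leq_trans (leq_addl _ _).
  by rewrite leq_mul2r mulnC leq_mul2r; apply/orP; right; apply/orP; right; lia.
rewrite mul0n addn0.
have nk2 : (n - k).+1 ^ 2 * n`! <= n ^ 2 * n`!.
  by rewrite leq_mul2r leq_exp2r //; apply/orP; right; lia.
apply: leq_trans (leq_add (leqnn _) (leq_trans (sum_window_collisions Mk) nk2)).
rewrite -mulnDl leq_mul2r -big_split /=; apply/orP; right.
rewrite -card_Sn -sum_nat_const; apply: leq_sum => s _.
by rewrite subSn // leq_patterns_collisions.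
Qed.

End WindowPatterns.

(** * Summation over all lengths *)

Lemma sum_window_counts n : 2 * \sum_(1 <= k < n.+1) (n.+1 - k) = n * n.+1.
Proof.
rewrite big_add1 big_nat_rev /=.
rewrite (eq_big_nat _ _ (F2 := fun k => k.+1)); last by move=> i; lia.
elim: n => [|n IHn]; first by rewrite big_nil.
by rewrite big_nat_recr //= mulnDr IHn; lia.
Qed.

Lemma sum_ltn_leq n L : \sum_(1 <= k < n.+1) (k < L) <= L.
Proof.
elim: n => [|n IHn]; first by rewrite big_nil.
have [nL|Ln] := ltnP n.+1 L.
  apply: (@leq_trans (\sum_(1 <= k < n.+2) 1)).
    by apply: leq_sum => k _; exact: leq_b1.
  by rewrite sum_nat_const_nat; lia.
by rewrite big_nat_recr //= ltnNge Ln addn0.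
Qed.

(** The threshold is sharp: 4^12 < 11! but 4^11 > 10!. The exponent [M.+1] will absorb the rounding
    of [M] down to an integer. *)
Lemma four_expn_le_fact M : 11 <= M -> 4 ^ M.+1 <= M`!.
Proof.
elim: M => [//|M IHM]; rewrite leq_eqVlt => /orP[/eqP<-|M_ge].
  by rewrite !factS fact0 !expnS expn0; lia.
by rewrite expnS factS leq_mul ?IHM //; lia.
Qed.

Lemma sum_num_consec_patterns_ge n M : n ^ 2 <= M`! ->
  n`! * (n * n.+1) <=
    2 * (\sum_(s : 'S_n) num_consec_patterns s) + n`! * (2 * n + 4 * M * n).
Proof.
move=> nM; rewrite -(@leq_pmul2r M`!) ?fact_gt0//.
have : \sum_(1 <= k < n.+1) (n`! * (n.+1 - k) * M`!) <=
    \sum_(1 <= k < n.+1)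
      ((\sum_(s : 'S_n) #|[set mu : 'S_k | consec_contains s mu]|) * M`! +
       n ^ 2 * n`! + (k < 2 * M) * (n * n`! * M`!)).
  rewrite big_nat_cond [X in _ <= X]big_nat_cond; apply: leq_sum => k.
  by rewrite andbT => /andP[k_gt0 kn]; exact: leq_sum_patterns.
rewrite !big_split /= -!big_distrl /= -big_distrr /= sum_nat_const_nat.
rewrite exchange_big /= -sum_window_counts subn1 /= => H.
have H1 : n * n * n * n`! <= n * (M`! * n`!).
  by rewrite mulnA leq_mul // -mulnA mulnn leq_mul.
have H2 : (\sum_(1 <= k < n.+1) (k < 2 * M)) * (n * n`! * M`!) <=
    2 * M * (n * n`! * M`!) by rewrite leq_mul // sum_ltn_leq.
move: H H1 H2.
rewrite -[\sum_(s : 'S_n) _]/(\sum_(s : 'S_n) num_consec_patterns s).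
move: (\sum_(1 <= k < n.+1) (k < _)) (\sum_(1 <= k < n.+1) _) => B W.
move: (\sum_(s : 'S_n) _) (n`!) (M`!) => S F G.
clear; lia.
Qed.

Import Order.TTheory GRing.Theory Num.Theory.
Local Open Scope ring_scope.

(** * Logarithmic estimates and the expectation *)

Lemma expR1_le4 (R : realType) : expR 1 <= 4 :> R.
Proof.
(* Inverting this bound gives e^(1/2) <= 2, which is then squared. *)
have h : 1 / 2 <= expR (- (1 / 2)) :> R.
  by apply: le_trans (expR_ge1Dx _); lra.
have -> : 1 = 1 / 2 + 1 / 2 :> R by lra.
have p := expR_gt0 (1 / 2 : R); have e := expRxMexpNx_1 (1 / 2 : R).
rewrite expRD; nra.
Qed.

Lemma ln_nat_ge (R : realType) (n m : nat) :
  (4 ^ m <= n)%N -> m%:R <= ln n%:R :> R.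
Proof.
move=> mn; have n_gt0 : (0 < n)%N by rewrite (leq_trans _ mn) // expn_gt0.
rewrite -ler_expR lnK ?posrE ?ltr0n // -[m%:R]mulr1 expRM_natl.
rewrite (@le_trans _ _ (4 ^+ m)) ?lerXn2r ?nnegrE ?expR_ge0 ?expR1_le4 //.
by rewrite -natrX ler_nat.
Qed.

(** With M the truncation, n^2 = e^(2 ln n) <= e^(M+1) <= 4^(M+1) <= M!. The last step needs M >=
    11, which holds because ln n >= 6. *)
Lemma sqr_le_fact_trunc_ln (R : realType) (n : nat) : (4 ^ 6 <= n)%N ->
  (n ^ 2 <= (Num.trunc (2 * ln n%:R : R))`!)%N.
Proof.
move=> n_ge; have ln_ge6 := ln_nat_ge R n_ge; set L : R := ln n%:R in ln_ge6 *.
have n_gt0 : (0 < n)%N by rewrite (leq_trans _ n_ge) // expn_gt0.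
have L2_ge0 : 0 <= 2 * L by lra.
have /andP[_ ltM] := truncn_itv L2_ge0.
set M := Num.trunc _ in ltM *.
apply: (@leq_trans (4 ^ M.+1)); last first.
  apply: four_expn_le_fact; rewrite truncn_ge_nat //; lra.
rewrite -(@ler_nat R) !natrX -[n%:R](@lnK R) ?posrE ?ltr0n // -/L.
rewrite -expRM_natl (@le_trans _ _ (expR M.+1%:R)) ?ler_expR ?(ltW ltM) //.
by rewrite -[M.+1%:R]mulr1 expRM_natl lerXn2r ?nnegrE ?expR_ge0 ?expR1_le4//.
Qed.

Theorem theorem1p2 (R : realType) :
  exists N : nat, forall n : nat, (N <= n)%N ->
    n%:R ^+ 2 / 2 * (1 - 17 * ln n%:R / n%:R)
      <= finite_expectation (uniform_pmf R 'S_n)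
           (fun s : 'S_n => (num_consec_patterns s)%:R).
Proof.
exists (4 ^ 6)%N => n n_ge.
have ln_ge6 := ln_nat_ge R n_ge.
have n_gt0 : (0 < n)%N by rewrite (leq_trans _ n_ge) // expn_gt0.
have L2_ge0 : 0 <= 2 * ln n%:R :> R by lra.
have /andP[leM _] := truncn_itv L2_ge0.
have := sum_num_consec_patterns_ge (sqr_le_fact_trunc_ln R n_ge).
move: (Num.trunc _) leM => M leM.
rewrite -(@ler_nat R) natrD !natrM natrD !natrM natr_sum -[n.+1]addn1 natrD.
rewrite /finite_expectation /uniform_pmf -big_distrr /= card_Sn.
have F_gt0 : 0 < n`!%:R :> R by rewrite ltr0n fact_gt0.
have x_gt0 : 0 < n%:R :> R by rewrite ltr0n.
move: (\sum_(s : 'S_n) _) => S; rewrite [_^-1 * S]mulrC ler_pdivlMr //.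
move: (n`!%:R) F_gt0 => F F_gt0 H.
have -> : n%:R ^+ 2 / 2 * (1 - 17 * ln n%:R / n%:R) =
  n%:R ^+ 2 / 2 - 17 / 2 * (n%:R * ln n%:R) :> R by field; rewrite gt_eqF.
(* Since M <= 2 ln n, the bracket is at least n^2/2 - n/2 - 4 n ln n, and ln n >= 6 lets the term
   n/2 be absorbed into (17/2) n ln n. *)
apply: (@le_trans _ _ ((n%:R * (n%:R + 1) / 2 - n%:R - 2 * M%:R * n%:R) * F)).
  by rewrite ler_pM2r //; nra.
by lra.
Qed.
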